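(* Let $(Q,+,\cdot,\le)$ be an ordered field and $n\ge 2$, and assume $n=2$ or that $(Q,+,\cdot,\le)$ is a Euclidean field. Let $$\mathcal{E}_{\tau\to\sigma}(p,q):=\exists r\,\exists x\,\exists s\,\exists z\,\big(r\,\tau\,p\wedge r\,\tau\,q\wedge x\,\tau\,p\wedge\neg(x\,\tau\,q)\wedge\neg(s\,\tau\,p)\wedge\neg(s\,\tau\,q)\wedge\neg(z\,\tau\,p)\wedge z\,\tau\,q\wedge\neg(r\,\tau\,x)\wedge r\,\tau\,s\wedge\neg(r\,\tau\,z)\big),$$ $$\mathcal{U}_{\tau\to\lambda}(p,q):=\neg\mathcal{E}_{\tau\to\sigma}(p,q)\wedge p\neq q\wedge\neg(p\,\tau\,q).$$ Then (1) in $(Q^n,\tau)$ the existential formula $\mathcal{E}_{\tau\to\sigma}$ (with 4 quantifiers, 6 variables) defines the relation $\sigma$; and (2) in $(Q^n,\tau)$ the formula $\mathcal{U}_{\tau\to\lambda}$ (equivalent to a universal formula with 4 quantifiers, 6 variables) defines the relation $\lambda$.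
   Context: For $p=(p_0,\dots,p_{n-1}),\,q=(q_0,\dots,q_{n-1})\in Q^n$: $p\,\tau\,q$ iff $(p_0-q_0)^2>\sum_{i=1}^{n-1}(p_i-q_i)^2$; $p\,\lambda\,q$ iff $(p_0-q_0)^2=\sum_{i=1}^{n-1}(p_i-q_i)^2$ and $p_0\neq q_0$; $p\,\sigma\,q$ iff $(p_0-q_0)^2<\sum_{i=1}^{n-1}(p_i-q_i)^2$. An ordered field is Euclidean if every nonnegative element is a square. A formula $\varphi(p,q)$ defines $R$ in $(Q^n,\tau)$ if for all $a,b\in Q^n$, $\varphi(a,b)$ holds (symbol $\tau$ interpreted as $\tau$, quantifiers over $Q^n$) iff $(a,b)\in R$. *)

(* Defs.v *)
From HB Require Import structures.
From mathcomp Require Import all_boot all_order all_algebra.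

Set Implicit Arguments.
Unset Strict Implicit.
Unset Printing Implicit Defensive.

Import Order.TTheory GRing.Theory Num.Theory.
Local Open Scope ring_scope.

(* Points of Q^n are n-tuples p, with p_i written p`_i. *)

Definition tau (Q : realFieldType) (n : nat) (p q : n.-tuple Q) : Prop :=
  (p`_0 - q`_0) ^+ 2 > \sum_(1 <= i < n) (p`_i - q`_i) ^+ 2.

Definition lambda (Q : realFieldType) (n : nat) (p q : n.-tuple Q) : Prop :=
  (p`_0 - q`_0) ^+ 2 = \sum_(1 <= i < n) (p`_i - q`_i) ^+ 2 /\ p`_0 <> q`_0.

Definition sigma (Q : realFieldType) (n : nat) (p q : n.-tuple Q) : Prop :=
  (p`_0 - q`_0) ^+ 2 < \sum_(1 <= i < n) (p`_i - q`_i) ^+ 2.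

Definition euclidean (Q : realFieldType) : Prop :=
  forall x : Q, 0 <= x -> exists y : Q, x = y ^+ 2.

(* First-order formulas, with equality, over one binary relation symbol.
   Variables are named by natural numbers. *)
Inductive formula : Type :=
| Rel of nat & nat
| Equ of nat & nat
| Not of formula
| And of formula & formula
| Or of formula & formula
| Imp of formula & formula
| Ex of nat & formula
| All of nat & formula.

Declare Scope fo_scope.
Delimit Scope fo_scope with fo.
Bind Scope fo_scope with formula.
Notation "~' f" := (Not f) (at level 75, right associativity) : fo_scope.
Notation "f /\' g" := (And f g) (at level 80, right associativity) : fo_scope.

Fixpoint holds (M : Type) (R : M -> M -> Prop) (v : nat -> M) (f : formula)
  : Prop :=
  match f with
  | Rel i j => R (v i) (v j)
  | Equ i j => v i = v j
  | Not g => ~ holds R v g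
  | And g h => holds R v g /\ holds R v h
  | Or g h => holds R v g \/ holds R v h
  | Imp g h => holds R v g -> holds R v h
  | Ex i g => exists a : M, holds R [eta v with i |-> a] g
  | All i g => forall a : M, holds R [eta v with i |-> a] g
  end.

Fixpoint free_vars (f : formula) : seq nat :=
  match f with
  | Rel i j | Equ i j => [:: i; j]
  | Not g => free_vars g
  | And g h | Or g h | Imp g h => free_vars g ++ free_vars h
  | Ex i g | All i g => [seq j <- free_vars g | j != i]
  end.

Fixpoint all_vars (f : formula) : seq nat :=
  match f with
  | Rel i j | Equ i j => [:: i; j]
  | Not g => all_vars g
  | And g h | Or g h | Imp g h => all_vars g ++ all_vars h
  | Ex i g | All i g => i :: all_vars g
  end.

Definition num_vars (f : formula) : nat := size (undup (all_vars f)).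

Fixpoint num_quantifiers (f : formula) : nat :=
  match f with
  | Rel _ _ | Equ _ _ => 0%N
  | Not g => num_quantifiers g
  | And g h | Or g h | Imp g h => (num_quantifiers g + num_quantifiers h)%N
  | Ex _ g | All _ g => (num_quantifiers g).+1
  end.

Fixpoint existential (f : formula) : bool :=
  if f is Ex _ g then existential g else num_quantifiers f == 0%N.

Fixpoint universal (f : formula) : bool :=
  if f is All _ g then universal g else num_quantifiers f == 0%N.

Definition equivalent (f g : formula) : Prop :=
  forall (M : Type) (R : M -> M -> Prop) (v : nat -> M),
    holds R v f <-> holds R v g.

Definition var_p : nat := 0%N.
Definition var_q : nat := 1%N.
Definition var_r : nat := 2%N.
Definition var_x : nat := 3%N.
Definition var_s : nat := 4%N.
Definition var_z : nat := 5%N.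

(* f is of the form f(p, q) *)
Definition formula_in_pq (f : formula) : Prop :=
  {subset free_vars f <= [:: var_p; var_q]}.

(* As only p and q may be free in f, f(a, b) is the value of f under any
   assignment v with v p = a and v q = b. *)
Definition defines (M : Type) (R : M -> M -> Prop) (f : formula)
    (S : M -> M -> Prop) : Prop :=
  formula_in_pq f /\
  forall (a b : M) (v : nat -> M), v var_p = a -> v var_q = b ->
    (holds R v f <-> S a b).

Definition E_tau_sigma : formula :=
  (Ex var_r (Ex var_x (Ex var_s (Ex var_z
    (Rel var_r var_p /\' Rel var_r var_q /\'
     Rel var_x var_p /\' ~' Rel var_x var_q /\'
     ~' Rel var_s var_p /\' ~' Rel var_s var_q /\'
     ~' Rel var_z var_p /\' Rel var_z var_q /\'
     ~' Rel var_r var_x /\' Rel var_r var_s /\' ~' Rel var_r var_z)))))%fo.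

Definition U_tau_lambda : formula :=
  (~' E_tau_sigma /\' ~' Equ var_p var_q /\' ~' Rel var_p var_q)%fo.

(* Main.v *)
(* A witness for E_tau_sigma (p, q) with p, q spacelike lies in the plane
   through p spanned by d = q - p and a timelike vector u orthogonal to d, scaled
   so that u and d have opposite Minkowski squares. With P a b = p + a u + b d,
   P a b and P a' b' are tau-related iff (b - b')^2 < (a - a')^2, and one takes
   r = P 1 (1/2), x = P 1 (-1/2), s = P 0 (1/2), z = P 1 (3/2). Scaling u requires
   the Euclidean length of the spatial part of d to be in Q: this is where n = 2
   or Q Euclidean is used.
   Conversely, let q be in the closed future cone of p (up to exchanging p with q
   and x with z), and write << for chronological precedence. Then p << x and
   z << q. If q << r then z << r; if r << p then r << x; and if p << r << q, any s
   with r tau s satisfies p << s or s << q. *)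
Require Import Defs.
From mathcomp Require Import all_boot all_order all_algebra.
From mathcomp Require Import ring lra.

Set Implicit Arguments.
Unset Strict Implicit.
Unset Printing Implicit Defensive.

Import Order.TTheory GRing.Theory Num.Theory.
Local Open Scope ring_scope.

(** The form x^2 A - 2xyC + y^2 B is a sum of squares, hence nonnegative; suitable x and y yield the
    bound inside any ordered field, without roots. *)
Lemma cauchy_schwarz_sum (Q : realFieldType) (I : Type) (s : seq I)
    (f g : I -> Q) :
  (\sum_(i <- s) f i * g i) ^+ 2 <=
  (\sum_(i <- s) f i ^+ 2) * (\sum_(i <- s) g i ^+ 2).
Proof.
set A := \sum_(i <- s) f i ^+ 2; set B := \sum_(i <- s) g i ^+ 2.
set C := \sum_(i <- s) f i * g i.
have quad_ge0 x y : 0 <= x ^+ 2 * A - 2 * x * y * C + y ^+ 2 * B.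
  have -> : x ^+ 2 * A - 2 * x * y * C + y ^+ 2 * B =
            \sum_(i <- s) (x * f i - y * g i) ^+ 2.
    rewrite !mulr_sumr -sumrB -big_split /=.
    by apply: eq_bigr => i _; ring.
  by apply: sumr_ge0 => i _; exact: sqr_ge0.
have A_ge0 : 0 <= A by apply: sumr_ge0 => i _; exact: sqr_ge0.
have [A_gt0|A_le0] := ltP 0 A.
  have := quad_ge0 C A.
  have -> : C ^+ 2 * A - 2 * C * A * C + A ^+ 2 * B = A * (A * B - C ^+ 2).
    by ring.
  by rewrite pmulr_rge0 // subr_ge0.
have A0 : A = 0 by apply: le_anti; rewrite A_le0.
(* With A = 0 the form takes the value -(B + 2) C^2 here, which forces C^2 <= 0. *)
have := quad_ge0 (B + 1) C; rewrite A0.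
have B_ge0 : 0 <= B by apply: sumr_ge0 => i _; exact: sqr_ge0.
have -> : (B + 1) ^+ 2 * 0 - 2 * (B + 1) * C * C + C ^+ 2 * B =
          - ((B + 2) * C ^+ 2) by ring.
by rewrite oppr_ge0 pmulr_rle0 ?mul0r //; lra.
Qed.

(** * Chronological and causal precedence *)

Section Causality.
Variables (Q : realFieldType) (n : nat).
Implicit Types (p q r a b c : n.-tuple Q).

Definition spatial_sqdist p q : Q := \sum_(1 <= i < n) (p`_i - q`_i) ^+ 2.

Definition chrono p q : Prop := p`_0 < q`_0 /\ tau p q.

Definition causal p q : Prop :=
  p`_0 <= q`_0 /\ spatial_sqdist p q <= (p`_0 - q`_0) ^+ 2.

Lemma spatial_sqdist_ge0 p q : 0 <= spatial_sqdist p q.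
Proof. by apply: sumr_ge0 => i _; exact: sqr_ge0. Qed.

Lemma spatial_sqdistC p q : spatial_sqdist p q = spatial_sqdist q p.
Proof. by apply: eq_bigr => i _; rewrite -sqrrN opprB. Qed.

Lemma tauC p q : tau p q -> tau q p.
Proof.
by rewrite /tau -!/(spatial_sqdist _ _) spatial_sqdistC -sqrrN opprB.
Qed.

Lemma chrono_causal p q : chrono p q -> causal p q.
Proof. by case=> lt_pq tau_pq; split; exact: ltW. Qed.

Lemma tau_chrono p q : tau p q -> chrono p q \/ chrono q p.
Proof.
move=> tau_pq; have [lt_pq|lt_qp|eq_pq] := ltgtP p`_0 q`_0.
- by left.
- by right; split=> //; exact: tauC.
- move: tau_pq; rewrite /tau eq_pq subrr expr0n /= => /lt_geF.
  by rewrite -/(spatial_sqdist p q) spatial_sqdist_ge0.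
Qed.

(** A squared triangle inequality. Distances need not lie in Q, so the bounds t and u stand in for
    them in the cross term, which Cauchy-Schwarz controls. *)
Lemma spatial_sqdist_triangle a b c (t u : Q) :
  0 <= t -> 0 <= u ->
  spatial_sqdist a b <= t ^+ 2 -> spatial_sqdist b c <= u ^+ 2 ->
  spatial_sqdist a c <= spatial_sqdist a b + spatial_sqdist b c + 2 * (t * u).
Proof.
move=> t_ge0 u_ge0 le_ab le_bc.
pose C := \sum_(1 <= i < n) (a`_i - b`_i) * (b`_i - c`_i).
have -> : spatial_sqdist a c =
          spatial_sqdist a b + spatial_sqdist b c + 2 * C.
  rewrite /spatial_sqdist /C mulr_sumr -!big_split /=.
  by apply: eq_bigr => i _; ring.
rewrite lerD2l ler_pM2l ?ltr0n //.
have le_C : C ^+ 2 <= (t * u) ^+ 2.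
  rewrite exprMn; apply: le_trans (cauchy_schwarz_sum _ _ _) _.
  by apply: ler_pM => //; exact: spatial_sqdist_ge0.
have [C_ge0|C_lt0] := leP 0 C.
  by move: le_C; rewrite ler_sqr // nnegrE mulr_ge0.
by apply: le_trans (ltW C_lt0) _; exact: mulr_ge0.
Qed.

Lemma chrono_causal_trans a b c : chrono a b -> causal b c -> chrono a c.
Proof.
move=> [lt_ab tau_ab] [le_bc cone_bc].
split; first exact: lt_le_trans le_bc.
have := @spatial_sqdist_triangle a b c (b`_0 - a`_0) (c`_0 - b`_0).
move: tau_ab cone_bc; rewrite /tau -!/(spatial_sqdist _ _).
rewrite !subr_ge0 -(opprB b`_0) -(opprB c`_0 b`_0) !sqrrN => tau_ab cone_bc.
move=> /(_ (ltW lt_ab) le_bc (ltW tau_ab) cone_bc) ac.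
(* With t and u the two time differences, the bound is below t^2 + u^2 + 2tu = (t + u)^2, strictly
   because of [tau_ab]. *)
by apply: le_lt_trans ac _; nra.
Qed.

Lemma causal_chrono_trans a b c : causal a b -> chrono b c -> chrono a c.
Proof.
move=> [le_ab cone_ab] [lt_bc tau_bc].
split; first exact: le_lt_trans lt_bc.
have := @spatial_sqdist_triangle a b c (b`_0 - a`_0) (c`_0 - b`_0).
move: cone_ab tau_bc; rewrite /tau -!/(spatial_sqdist _ _).
rewrite !subr_ge0 -(opprB b`_0) -(opprB c`_0 b`_0) !sqrrN => cone_ab tau_bc.
move=> /(_ le_ab (ltW lt_bc) cone_ab (ltW tau_bc)) ac.
by apply: le_lt_trans ac _; nra.
Qed.

Lemma chrono_trans a b c : chrono a b -> chrono b c -> chrono a c.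
Proof. by move=> ab /chrono_causal; exact: chrono_causal_trans. Qed.

(** * Configurations force a spacelike pair *)

Definition configuration p q r x s z : Prop :=
  tau r p /\ tau r q /\ tau x p /\ ~ tau x q /\ ~ tau s p /\ ~ tau s q /\
  ~ tau z p /\ tau z q /\ ~ tau r x /\ tau r s /\ ~ tau r z.

Lemma configuration_swap p q r x s z :
  configuration p q r x s z -> configuration q p r z s x.
Proof. by rewrite /configuration; tauto. Qed.

Lemma configuration_not_causal p q r x s z :
  configuration p q r x s z -> ~ causal p q.
Proof.
case=> rp [rq [xp [nxq [nsp [nsq [nzp [zq [nrx [rs nrz]]]]]]]]] pq.
have px : chrono p x.
  case: (tau_chrono xp) => // lt_xp.
  by case: nxq; exact: (chrono_causal_trans lt_xp pq).2.
have {}zq : chrono z q.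
  case: (tau_chrono zq) => // lt_qz.
  by case: nzp; apply: tauC; exact: (causal_chrono_trans pq lt_qz).2.
case: (tau_chrono rp) => [lt_rp|lt_pr].
  by case: nrx; exact: (chrono_trans lt_rp px).2.
case: (tau_chrono rq) => [lt_rq|lt_qr]; last first.
  by case: nrz; apply: tauC; exact: (chrono_trans zq lt_qr).2.
case: (tau_chrono rs) => [lt_rs|lt_sr].
  by case: nsp; apply: tauC; exact: (chrono_trans lt_pr lt_rs).2.
by case: nsq; exact: (chrono_trans lt_sr lt_rq).2.
Qed.

Lemma configuration_sigma p q r x s z :
  configuration p q r x s z -> sigma p q.
Proof.
move=> conf; rewrite /sigma -/(spatial_sqdist p q) ltNge; apply/negP => cone.
case/orP: (le_total p`_0 q`_0) => le_pq.
  exact: configuration_not_causal conf (conj le_pq cone).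
apply: (configuration_not_causal (configuration_swap conf)); split=> //.
by rewrite spatial_sqdistC -sqrrN opprB.
Qed.

End Causality.

Lemma nth_mktuple_nat (Q : realFieldType) (n : nat) (f : nat -> Q) (i : nat) :
  (i < n)%N -> [tuple f j | j < n]`_i = f i.
Proof. by move=> lt_in; rewrite (nth_mktuple _ _ (Ordinal lt_in)). Qed.

(** * Configurations for a given spacelike pair *)

Section Plane.
Variables (Q : realFieldType) (n : nat) (p q : n.-tuple Q) (L : Q).
Hypotheses (n_gt0 : (0 < n)%N) (L_neq0 : L != 0).
Hypothesis sqr_L : L ^+ 2 = spatial_sqdist p q.

(* [p + a u + b d] with [d = q - p] and [u] orthogonal to [d]: the time part of
   [u] is [L], its spatial part is that of [d] multiplied by [d_0 / L]. *)
Definition plane_point (a b : Q) : n.-tuple Q :=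
  [tuple p`_j + (if j == 0 :> nat then a * L + b * (q`_0 - p`_0)
                 else (a * (q`_0 - p`_0) / L + b) * (q`_j - p`_j)) | j < n].

Lemma plane_point0 a b :
  (plane_point a b)`_0 = p`_0 + (a * L + b * (q`_0 - p`_0)).
Proof.
by rewrite /plane_point (nth_mktuple_nat (fun j => p`_j + (if j == 0%N then _
  else (a * (q`_0 - p`_0) / L + b) * (q`_j - p`_j))) n_gt0).
Qed.

Lemma plane_pointS a b i : (1 <= i < n)%N ->
  (plane_point a b)`_i = p`_i + (a * (q`_0 - p`_0) / L + b) * (q`_i - p`_i).
Proof.
case/andP=> i_gt0 lt_in.
rewrite /plane_point (nth_mktuple_nat (fun j => p`_j + (if j == 0%N then _
  else (a * (q`_0 - p`_0) / L + b) * (q`_j - p`_j))) lt_in).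
by rewrite -(prednK i_gt0).
Qed.

Lemma plane_point00 : plane_point 0 0 = p.
Proof.
apply: val_inj; apply: (@eq_from_nth _ 0); rewrite ?size_tuple // => -[|i] lt_in.
  by rewrite plane_point0; ring.
by rewrite plane_pointS // !mul0r !addr0 mul0r addr0.
Qed.

Lemma plane_point01 : plane_point 0 1 = q.
Proof.
apply: val_inj; apply: (@eq_from_nth _ 0); rewrite ?size_tuple // => -[|i] lt_in.
  by rewrite plane_point0; ring.
by rewrite plane_pointS // !mul0r add0r mul1r addrC subrK.
Qed.

(** The Minkowski squares of u and d are K and -K with K = L^2 - d_0^2 > 0, so by orthogonality the
    difference has square K ((a - a')^2 - (b - b')^2). *)
Lemma tau_plane_point a b a' b' : (q`_0 - p`_0) ^+ 2 < L ^+ 2 ->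
  tau (plane_point a b) (plane_point a' b') <-> (b - b') ^+ 2 < (a - a') ^+ 2.
Proof.
move=> spacelike; rewrite /tau !plane_point0; set d0 := q`_0 - p`_0 in spacelike *.
have -> : \sum_(1 <= i < n) ((plane_point a b)`_i - (plane_point a' b')`_i) ^+ 2
          = ((a - a') * d0 / L + (b - b')) ^+ 2 * L ^+ 2.
  rewrite sqr_L spatial_sqdistC mulr_sumr; apply: eq_big_nat => i lt_in.
  by rewrite !plane_pointS // -/d0; ring.
rewrite -subr_gt0 -[in X in _ <-> X]subr_gt0.
have -> : (p`_0 + (a * L + b * d0) - (p`_0 + (a' * L + b' * d0))) ^+ 2 -
          ((a - a') * d0 / L + (b - b')) ^+ 2 * L ^+ 2 =
          (L ^+ 2 - d0 ^+ 2) * ((a - a') ^+ 2 - (b - b') ^+ 2) by field.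
by rewrite pmulr_rgt0 // subr_gt0.
Qed.

Lemma plane_configuration : sigma p q ->
  configuration p q (plane_point 1 (1 / 2)) (plane_point 1 (- (1 / 2)))
    (plane_point 0 (1 / 2)) (plane_point 1 (3 / 2)).
Proof.
move=> pq.
have spacelike : (q`_0 - p`_0) ^+ 2 < L ^+ 2.
  by rewrite -sqrrN opprB sqr_L.
have tauE := tau_plane_point _ _ _ _ spacelike.
(* In coordinates (a, b), p, s, q lie at level a = 0 and x, r, z at level a = 1. Points of one level
   are unrelated; across levels, related means |b - b'| < 1. *)
have : configuration (plane_point 0 0) (plane_point 0 1) (plane_point 1 (1 / 2))
    (plane_point 1 (- (1 / 2))) (plane_point 0 (1 / 2)) (plane_point 1 (3 / 2)).
  rewrite /configuration !tauE.
  by do ?split; try (apply/negP; rewrite -leNgt); lra.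
by rewrite plane_point00 plane_point01.
Qed.

End Plane.

Lemma spatial_length (Q : realFieldType) (n : nat) (p q : n.-tuple Q) :
  n = 2%N \/ euclidean Q -> exists L : Q, L ^+ 2 = spatial_sqdist p q.
Proof.
case=> [n2|euclQ].
  by subst n; exists (p`_1 - q`_1); rewrite /spatial_sqdist big_nat1.
by have [L ->] := euclQ _ (spatial_sqdist_ge0 p q); exists L.
Qed.

Lemma sigma_configuration (Q : realFieldType) (n : nat) (p q : n.-tuple Q) :
  (0 < n)%N -> n = 2%N \/ euclidean Q -> sigma p q ->
  exists r x s z, configuration p q r x s z.
Proof.
move=> n_gt0 hQ pq; have [L sqr_L] := spatial_length p q hQ.
have L_neq0 : L != 0.
  rewrite -sqrf_eq0 sqr_L gt_eqF //.
  exact: le_lt_trans (sqr_ge0 _) pq.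
by do 4!eexists; exact: (plane_configuration n_gt0 L_neq0 sqr_L pq).
Qed.

Lemma holds_E_tau_sigma (Q : realFieldType) (n : nat) (v : nat -> n.-tuple Q) :
  (0 < n)%N -> n = 2%N \/ euclidean Q ->
  holds (@tau Q n) v E_tau_sigma <-> sigma (v var_p) (v var_q).
Proof.
move=> n_gt0 hQ; split; last exact: sigma_configuration.
by case=> r [x [s [z conf]]]; exact: (@configuration_sigma _ _ _ _ r x s z).
Qed.

(** By trichotomy only the null case remains. There equal times would make a sum of squares vanish,
    giving p = q. *)
Lemma not_sigma_not_tau_lambda (Q : realFieldType) (n : nat) (p q : n.-tuple Q) :
  (~ sigma p q /\ p <> q /\ ~ tau p q) <-> lambda p q.
Proof.
rewrite /sigma /tau /lambda; split=> [[nsig [neq_pq ntau]]|[null neq0]].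
  have null : (p`_0 - q`_0) ^+ 2 = \sum_(1 <= i < n) (p`_i - q`_i) ^+ 2.
    by apply: le_anti; rewrite !leNgt; apply/andP; split; apply/negP.
  split=> // eq0; apply: neq_pq; apply: val_inj; apply: (@eq_from_nth _ 0).
    by rewrite !size_tuple.
  rewrite size_tuple => -[//|i] lt_in.
  move/esym/eqP: null; rewrite eq0 subrr expr0n /= psumr_eq0; last first.
    by move=> j _; exact: sqr_ge0.
  move/allP/(_ i.+1); rewrite mem_index_iota lt_in => /(_ isT) /=.
  by rewrite sqrf_eq0 subr_eq0 => /eqP.
by rewrite null ltxx; split=> //; split=> // eq_pq; apply: neq0; rewrite eq_pq.
Qed.

(** The match extracts the matrix of [E_tau_sigma]; the other two conjuncts involve only p and q and
    so may move under the quantifiers. *)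
Definition prenex_U_tau_lambda : formula :=
  (if E_tau_sigma is Ex i (Ex j (Ex k (Ex l body)))
   then All i (All j (All k (All l
     (~' body /\' ~' Equ var_p var_q /\' ~' Rel var_p var_q))))
   else U_tau_lambda)%fo.

Lemma prenex_U_tau_lambda_equivalent :
  equivalent prenex_U_tau_lambda U_tau_lambda.
Proof.
move=> M R v; split=> [U|[nE [neq nrel]] r x s z].
  (* Reading off the conjuncts on p and q takes some element of M; the assignment supplies one. *)
  have [_ [neq nrel]] := U (v 0) (v 0) (v 0) (v 0).
  split; last by split.
  by case=> r [x [s [z conf]]]; have [] := U r x s z.
split; last by split.
by move=> conf; apply: nE; exists r, x, s, z.
Qed.

Theorem theorem4p1 (Q : realFieldType) (n : nat) (hn : (2 <= n)%N)
    (hQ : n = 2%N \/ euclidean Q) :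
  (existential E_tau_sigma /\
   num_quantifiers E_tau_sigma = 4%N /\
   num_vars E_tau_sigma = 6%N /\
   defines (@tau Q n) E_tau_sigma (@sigma Q n)) /\
  (defines (@tau Q n) U_tau_lambda (@lambda Q n) /\
   exists psi : formula,
     formula_in_pq psi /\
     universal psi /\
     num_quantifiers psi = 4%N /\
     num_vars psi = 6%N /\
     equivalent psi U_tau_lambda).
Proof.
have n_gt0 : (0 < n)%N := ltnW hn.
split.
  do 3!split=> //; split; first exact/allP.
  by move=> a b v <- <-; exact: holds_E_tau_sigma.
split.
  split; first exact/allP.
  move=> a b v <- <-; rewrite -not_sigma_not_tau_lambda.
  by rewrite -(holds_E_tau_sigma v n_gt0 hQ).
exists prenex_U_tau_lambda; split; first exact/allP.
by do 3!split=> //; exact: prenex_U_tau_lambda_equivalent.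
Qed.
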